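(* Up to Euclidean isometry, the only Eisenstein lattice equable parallelograms with a horizontal diagonal are the parallelograms $P_n=OA_nB_nC_n$, $n\ge 0$, defined in the context; that is, every ELEP having a horizontal diagonal is congruent to $P_n$ for some integer $n\ge0$.
   Context: A planar polygon is equable if its perimeter equals its area. The Eisenstein lattice is $\mathbb{Z}[\omega]\subset\mathbb{C}$, where $\omega=-\frac12+i\frac{\sqrt3}{2}$. An Eisenstein lattice equable parallelogram (ELEP) is an equable parallelogram whose vertices all lie in $\mathbb{Z}[\omega]$. Horizontal means parallel to the real axis ($x$-axis). Let $(u_n)_{n\ge0}$ be defined by $u_0=0$, $u_1=1$, $u_n=4u_{n-1}-u_{n-2}$. In Cartesian coordinates let $O=(0,0)$ and $$A_n=(-6u_n,-2\sqrt3),\quad B_n=(6u_{n+1}-6u_n,0),\quad C_n=(6u_{n+1},2\sqrt3).$$ For each $n\ge0$, $P_n=OA_nB_nC_n$ is the parallelogram with these consecutive vertices; it is an ELEP whose diagonal $OB_n$ is horizontal. *)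

(* Defs.v *)
From Stdlib Require Import Reals Lra Lia ZArith List.
From Coquelicot Require Import Complex.
Import ListNotations.
Open Scope R_scope.

(* The Euclidean plane is [C] = [R * R], so that [(x, y)] is the point with
   Cartesian coordinates x and y.  A polygon is the list of its consecutive
   vertices, the last vertex being joined to the first. *)

Definition omega : C := (- (1 / 2), sqrt 3 / 2).

Definition eisenstein (z : C) : Prop :=
  exists a b : Z, z = (RtoC (IZR a) + RtoC (IZR b) * omega)%C.

Definition cross (z w : C) : R := Re z * Im w - Im z * Re w.

Definition sides (p : list C) : list (C * C) :=
  combine p (tl p ++ firstn 1 p).

Definition sum_list (l : list R) : R := fold_right Rplus 0 l.

Definition perimeter (p : list C) : R :=
  sum_list (map (fun s => Cmod (snd s - fst s)%C) (sides p)).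

(* The shoelace formula, which gives the area of every simple polygon. *)
Definition area (p : list C) : R :=
  Rabs (sum_list (map (fun s => cross (fst s) (snd s)) (sides p))) / 2.

Definition equable (p : list C) : Prop := perimeter p = area p.

(* The last conjunct says that a, b and d are not collinear. *)
Definition parallelogram (p : list C) : Prop :=
  match p with
  | [a; b; c; d] =>
      (b - a)%C = (c - d)%C /\ cross (b - a)%C (d - a)%C <> 0
  | _ => False
  end.

Definition ELEP (p : list C) : Prop :=
  parallelogram p /\ equable p /\ Forall eisenstein p.

Definition has_horizontal_diagonal (p : list C) : Prop :=
  match p with
  | [a; b; c; d] => Im a = Im c \/ Im b = Im d
  | _ => False
  end.

Definition isometry (f : C -> C) : Prop :=
  forall z w : C, Cmod (f z - f w)%C = Cmod (z - w)%C.

Definition rot {T : Type} (k : nat) (l : list T) : list T :=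
  skipn k l ++ firstn k l.

(* The vertex lists of one polygon differ by the choice of the first vertex
   and of the direction of travel. *)
Definition congruent (p q : list C) : Prop :=
  exists (f : C -> C) (k : nat),
    isometry f /\ (map f p = rot k q \/ map f p = rev (rot k q)).

Fixpoint u (n : nat) : Z :=
  match n with
  | O => 0%Z
  | S m => match m with
           | O => 1%Z
           | S k => (4 * u m - u k)%Z
           end
  end.

Definition ptA (n : nat) : C := (- 6 * IZR (u n), - 2 * sqrt 3).
Definition ptB (n : nat) : C := (6 * IZR (u (S n)) - 6 * IZR (u n), 0).
Definition ptC (n : nat) : C := (6 * IZR (u (S n)), 2 * sqrt 3).

Definition P (n : nat) : list C := [RtoC 0; ptA n; ptB n; ptC n].

Lemma u_SS (n : nat) : u (S (S n)) = (4 * u (S n) - u n)%Z.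
Proof. reflexivity. Qed.

Lemma u_spec (n : nat) :
  (0 <= u n)%Z /\ (2 * u n < u (S n))%Z /\
  (u (S n) * u (S n) - 4 * u (S n) * u n + u n * u n = 1)%Z.
Proof.
induction n as [|n IH]; [simpl; lia|].
rewrite u_SS. nia.
Qed.

Lemma P_ELEP (n : nat) : ELEP (P n) /\ has_horizontal_diagonal (P n).
Proof.
assert (E : forall x y : Z, eisenstein (IZR x, IZR y * sqrt 3)).
{ intros x y. exists (x + y)%Z, (2 * y)%Z.
  unfold omega, RtoC, Cplus, Cmult; cbn [fst snd].
  rewrite plus_IZR, mult_IZR. f_equal; field. }
assert (M : forall x y r, 0 <= r -> x * x + y * y = r * r -> Cmod (x, y) = r).
{ intros x y r Hr Er. unfold Cmod, fst, snd.
  replace (x ^ 2 + y ^ 2) with (r * r) by (simpl; lra).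
  now apply sqrt_square. }
assert (HE : Forall eisenstein (P n)).
{ unfold P; repeat apply Forall_cons; [| | | |apply Forall_nil]; unfold ptA, ptB, ptC, RtoC.
  - generalize (E 0%Z 0%Z). now rewrite Rmult_0_l.
  - generalize (E (-6 * u n)%Z (-2)%Z). now rewrite mult_IZR.
  - generalize (E (6 * u (S n) - 6 * u n)%Z 0%Z).
    now rewrite Rmult_0_l, minus_IZR, !mult_IZR.
  - generalize (E (6 * u (S n))%Z 2%Z). now rewrite mult_IZR. }
destruct (u_spec n) as [H0 [H1 H2]].
apply IZR_le in H0. apply IZR_lt in H1. apply (f_equal IZR) in H2.
rewrite plus_IZR, minus_IZR, !mult_IZR in H2. rewrite mult_IZR in H1.
assert (Hs : sqrt 3 * sqrt 3 = 3) by (apply sqrt_sqrt; lra).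
assert (Hp : 0 < sqrt 3) by (apply sqrt_lt_R0; lra).
split; [split; [|split; [|exact HE]]|left; reflexivity];
  unfold P, ptA, ptB, ptC, RtoC; clear HE E;
  set (a := IZR (u n)) in *; set (b := IZR (u (S n))) in *;
  set (s := sqrt 3) in *; clearbody a b s;
  assert (Hq : 0 < s * (b - a)) by (apply Rmult_lt_0_compat; lra);
  assert (Hx : 0 <= 2 * s * (b - 2 * a)) by (apply Rmult_le_pos; lra);
  assert (Hy : 0 <= 2 * s * (2 * b - a)) by (apply Rmult_le_pos; lra);
  assert (Ex : 2 * s * (b - 2 * a) * (2 * s * (b - 2 * a)) =
               36 * (a * a) + 12)
    by (transitivity (4 * (s * s) * (b * b - 4 * b * a + 4 * (a * a)));
        [ring | rewrite Hs; lra]);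
  assert (Ey : 2 * s * (2 * b - a) * (2 * s * (2 * b - a)) =
               36 * (b * b) + 12)
    by (transitivity (4 * (s * s) * (4 * (b * b) - 4 * b * a + a * a));
        [ring | rewrite Hs; lra]).
- unfold parallelogram, cross, Cminus, Cplus, Copp, Re, Im, fst, snd. split.
  + f_equal; ring.
  + intro H. ring_simplify in H. lra.
- unfold equable, perimeter, area, sum_list, sides, Cminus, Cplus, Copp, cross.
  cbn [combine tl app firstn map fold_right fst snd Re Im].
  rewrite (M _ _ (2 * s * (b - 2 * a)) Hx) by lra.
  rewrite (M _ _ (2 * s * (2 * b - a)) Hy) by lra.
  rewrite (M _ _ (2 * s * (b - 2 * a)) Hx) by lra.
  rewrite (M _ _ (2 * s * (2 * b - a)) Hy) by lra.
  unfold Re, Im, fst, snd.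
  match goal with |- _ = Rabs ?e / 2 =>
    replace e with (24 * (s * (b - a))) by ring end.
  rewrite Rabs_right; lra.
Qed.

(* Main.v *)
Require Import Defs.
From Stdlib Require Import Reals List.
From Coquelicot Require Import Complex.
From Stdlib Require Import Lra Lia ZArith Znumtheory.
Import ListNotations.
Open Scope R_scope.

(** Put one end of the horizontal diagonal at the origin; the sides are then
    (p/2, -k sqrt 3/2) and (q/2, k sqrt 3/2) with p, q, k integers, and after
    reflections k > 0 and p + q > 0.  Equability reads
    4 (sqrt (p^2 + 3 k^2) + sqrt (q^2 + 3 k^2)) = sqrt 3 * k (p + q).
    This forces both roots to be integer multiples m sqrt 3, n sqrt 3, so
    p = 3a, q = 3b with m^2 = 3a^2 + k^2, n^2 = 3b^2 + k^2 and
    4 (m + n) = 3k (a + b).  Eliminating m and n gives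
    (3k^2 - 16) ((3k^2 - 16)(a^2 + b^2) + 2ab (3k^2 + 16)) = 64 k^4,
    so 3k^2 - 16 divides 2^14 and k is 2 or 4.  The positivity of m and n
    excludes k = 2, and k = 4 leaves a^2 + 4ab + b^2 = 16, a Pell-type equation
    whose solutions are found by descent. *)

(** * Integer arithmetic: divisibility, descent, the Diophantine system *)

(** Dividing by the gcd leaves coprime [d'] and [x'] with d'^2 dividing x'^2; Gauss's lemma then
    gives d' | x'. *)
Lemma Zsquare_divide (d x : Z) : (d <> 0)%Z -> (d * d | x * x)%Z -> (d | x)%Z.
Proof.
intros Hd H.
destruct (Z.gcd_divide_l d x) as [d' Ed], (Z.gcd_divide_r d x) as [x' Ex].
assert (Hg : Z.gcd d x <> 0%Z) by (intro E; rewrite E in Ed; lia).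
assert (Hc : Z.gcd d' x' = 1%Z).
{ apply (Z.mul_cancel_r _ _ (Z.gcd d x) Hg).
  rewrite <- (Z.abs_eq (Z.gcd d x)) at 1 by apply Z.gcd_nonneg.
  rewrite <- Z.gcd_mul_mono_r, <- Ed, <- Ex. ring. }
set (g := Z.gcd d x) in *. clearbody g.
destruct H as [c Hc2]. subst d x.
assert (E : (x' * x' = c * d' * d')%Z).
{ apply (Z.mul_cancel_r _ _ (g * g)); nia. }
assert (D : (d' | x')%Z).
{ apply (Z.gauss _ x'); [exists (c * d')%Z; nia | exact Hc]. }
now apply Z.mul_divide_mono_r.
Qed.

(** Vieta jumping: for fixed [x] the other root of the quadratic in [y] is 4x - y, so (x, y)
    descends to (4x - y, x), which undoes one step of the recurrence of [u]. *)
Lemma pell_u (x y : Z) :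
  (0 <= x < y)%Z -> (x * x - 4 * x * y + y * y = 1)%Z ->
  exists n : nat, x = u n /\ y = u (S n).
Proof.
intros [Hx Hxy]. revert y Hxy. revert x Hx.
apply (Zlt_0_ind (fun x => forall y, (x < y)%Z ->
  (x * x - 4 * x * y + y * y = 1)%Z -> exists n, x = u n /\ y = u (S n))).
intros x IH Hx y Hxy E.
destruct (Z.eq_dec x 0) as [->|Hx0].
- exists 0%nat. assert (y = 1)%Z as -> by nia. split; reflexivity.
- assert (E' : (y * (4 * x - y) = x * x - 1)%Z) by nia.
  (* The product of the roots, x^2 - 1, is at least 0 and less than xy, hence 0 <= 4x - y < x. *)
  assert (L : (0 <= 4 * x - y)%Z) by (apply (Z.mul_le_mono_pos_l _ _ y); nia).
  assert (U : (4 * x - y < x)%Z) by (apply (Z.mul_lt_mono_pos_l y); nia).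
  destruct (IH (4 * x - y)%Z (conj L U) x U) as [n [E1 E2]]; [lia|].
  exists (S n). split; [exact E2|].
  rewrite u_SS, <- E1, <- E2. ring.
Qed.

Lemma divisor_condition (k f : Z) :
  (0 < k)%Z -> ((3 * k * k - 16) * f = 16384)%Z -> (k = 2 \/ k = 4)%Z.
Proof.
intros Hk E.
assert (L : (3 * k * k - 16 <= 16384)%Z).
{ apply Z.divide_pos_le; [lia|]. exists f. lia. }
(* 3 * 74^2 - 16 exceeds 2^14, so finitely many [k] remain, tested by computation. *)
assert (Hb : (k < 74)%Z) by nia.
assert (D : (16384 mod (3 * k * k - 16) = 0)%Z).
{ rewrite <- E, Z.mul_comm. apply Z_mod_mult. }
assert (A : forallb (fun i => let j := Z.of_nat i in
  orb (negb (16384 mod (3 * j * j - 16) =? 0)%Z) (orb (j =? 2)%Z (j =? 4)%Z))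
  (seq 1 73) = true) by (vm_compute; reflexivity).
rewrite forallb_forall in A.
specialize (A (Z.to_nat k)). rewrite in_seq in A.
specialize (A ltac:(lia)). cbv zeta in A.
rewrite Z2Nat.id, D in A by lia. simpl in A. lia.
Qed.

Lemma diophantine (a b k m n : Z) :
  (0 < k)%Z -> (0 < a + b)%Z -> (0 < m)%Z -> (0 < n)%Z ->
  (m * m = 3 * a * a + k * k)%Z -> (n * n = 3 * b * b + k * k)%Z ->
  (4 * (m + n) = 3 * k * (a + b))%Z ->
  k = 4%Z /\ exists i : nat,
    (a = - 4 * u i /\ b = 4 * u (S i) \/ b = - 4 * u i /\ a = 4 * u (S i))%Z.
Proof.
intros Hk Hab Hm Hn Em En E.
(* Divide 4(m^2 - n^2) = 12(a^2 - b^2) by 4(m + n) = 3k(a + b). *)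
assert (E1 : (k * (m - n) = 4 * (a - b))%Z).
{ apply (Z.mul_cancel_r _ _ (3 * (a + b))); [lia|].
  transitivity (4 * (m * m - n * n))%Z; [|rewrite Em, En; ring].
  transitivity ((m - n) * (3 * k * (a + b)))%Z; [ring|].
  rewrite <- E; ring. }
assert (E2 : (8 * k * m = a * (3 * k * k + 16) + b * (3 * k * k - 16))%Z).
{ transitivity (k * (4 * (m + n)) + 4 * (k * (m - n)))%Z; [ring|].
  rewrite E, E1. ring. }
assert (E3 : (8 * k * n = a * (3 * k * k - 16) + b * (3 * k * k + 16))%Z).
{ transitivity (k * (4 * (m + n)) - 4 * (k * (m - n)))%Z; [ring|].
  rewrite E, E1. ring. }
set (e := ((3 * k * k - 16) * (a * a + b * b) + 2 * a * b * (3 * k * k + 16))%Z).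
(* Square [E2]; since (3k^2 + 16)^2 - 192k^2 = (3k^2 - 16)^2, the factor 3k^2 - 16 comes out. *)
assert (E4 : ((3 * k * k - 16) * e = 64 * (k * k * k * k))%Z).
{ assert (S : ((8 * k * m) * (8 * k * m) = 64 * k * k * (3 * a * a + k * k))%Z)
    by (rewrite <- Em; ring).
  rewrite E2 in S. unfold e. lia. }
assert (E5 : k = 2%Z \/ k = 4%Z).
{ (* 9 * 64 k^4 = 64 (3k^2 - 16)(3k^2 + 16) + 2^14 *)
  apply (divisor_condition k (9 * e - 64 * (3 * k * k + 16)) Hk).
  transitivity (9 * ((3 * k * k - 16) * e)
                - 64 * (9 * (k * k * k * k) - 256))%Z; [ring|].
  rewrite E4. ring. }
unfold e in E4. clear e.
destruct E5 as [-> | ->].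
- (* m, n > 0 give b < 7a and a < 7b, hence a^2 + b^2 < 14ab, whereas
     [E4] reads a^2 + b^2 - 14ab = 64. *)
  exfalso. assert (b < 7 * a)%Z by lia. assert (a < 7 * b)%Z by lia. nia.
- split; [reflexivity|].
  assert (Q : (a * a + b * b + 4 * a * b = 16)%Z) by lia.
  (* Modulo 4 the form is x^2 + y^2, which vanishes only for even x and y. Two halvings reduce 16 to
     1. *)
  assert (even2 : forall x y c : Z, (x * x + y * y + 4 * x * y = 4 * c)%Z ->
    exists x' y', x = (2 * x')%Z /\ y = (2 * y')%Z).
  { intros x y c H. exists (x / 2)%Z, (y / 2)%Z.
    assert (Dx := Z.div_mod x 2 ltac:(lia)). assert (Dy := Z.div_mod y 2 ltac:(lia)).
    assert (Mx := Z.mod_pos_bound x 2 ltac:(lia)).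
    assert (My := Z.mod_pos_bound y 2 ltac:(lia)).
    set (x' := (x / 2)%Z) in *. set (y' := (y / 2)%Z) in *.
    assert (Cx : (x mod 2 = 0 \/ x mod 2 = 1)%Z) by lia.
    assert (Cy : (y mod 2 = 0 \/ y mod 2 = 1)%Z) by lia.
    destruct Cx as [Cx|Cx], Cy as [Cy|Cy]; rewrite Cx in Dx; rewrite Cy in Dy;
      clearbody x' y'; clear - H Dx Dy; subst x y; lia. }
  destruct (even2 a b 4%Z ltac:(lia)) as (a1 & b1 & -> & ->).
  destruct (even2 a1 b1 1%Z ltac:(lia)) as (x & y & -> & ->).
  assert (Q' : (x * x + y * y + 4 * x * y = 1)%Z) by lia.
  destruct (Z.le_gt_cases x 0) as [Hx|Hx].
  + destruct (pell_u (- x) y) as [i [Ex Ey]]; [lia|lia|].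
    exists i. left. lia.
  (* If both were positive, the form would be at least 6. *)
  + assert (Hy : (y <= 0)%Z) by nia.
    destruct (pell_u (- y) x) as [i [Ey Ex]]; [lia|lia|].
    exists i. right. lia.
Qed.

(** * From square roots to integers *)

(** As x + y is a rational multiple of sqrt 3 and x^2 - y^2 is an integer, x - y and hence x are
    rational multiples of sqrt 3. So 3M is a rational square, thus the square of an integer r, and 3
    | r. *)
Lemma three_times_square (x y : R) (M N t : Z) :
  (0 < t)%Z -> 0 <= x -> x * x = IZR M -> y * y = IZR N ->
  4 * (x + y) = sqrt 3 * IZR t ->
  exists m : Z, (0 <= m)%Z /\ x = sqrt 3 * IZR m /\ M = (3 * m * m)%Z.
Proof.
intros Ht Hx Ex Ey E.
assert (Hs : sqrt 3 * sqrt 3 = 3) by (apply sqrt_sqrt; lra).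
assert (Hp : 0 < sqrt 3) by (apply sqrt_lt_R0; lra).
set (s := sqrt 3) in *. clearbody s.
assert (Ht' := IZR_lt _ _ Ht).
assert (E1 : 8 * s * IZR t * x = 3 * (IZR t * IZR t) + 16 * (IZR M - IZR N)).
{ rewrite <- Ex, <- Ey.
  transitivity ((s * IZR t) * (8 * x)); [ring|].
  transitivity ((s * IZR t) * (s * IZR t) + 16 * (x * x - y * y)).
  - rewrite <- E. ring.
  - rewrite <- Hs. ring. }
assert (E2 : (3 * M * ((8 * t) * (8 * t)) =
  (3 * (t * t) + 16 * (M - N)) * (3 * (t * t) + 16 * (M - N)))%Z).
{ apply eq_IZR. rewrite !mult_IZR, !plus_IZR, !mult_IZR, !minus_IZR.
  rewrite <- E1, <- Ex, <- Hs. ring. }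
destruct (Zsquare_divide (8 * t) (3 * (t * t) + 16 * (M - N))) as [r Er];
  [lia | exists (3 * M)%Z; lia|].
assert (E3 : (3 * M = r * r)%Z).
{ rewrite Er in E2. apply (Z.mul_cancel_r _ _ ((8 * t) * (8 * t))); nia. }
destruct (prime_mult 3 prime_3 r r) as [D|D];
  [exists M; lia| |]; destruct D as [m Em];
  (assert (EM : M = (3 * m * m)%Z) by (subst r; lia);
   exists (Z.abs m); split; [lia|]; split; [|nia];
   apply Rsqr_inj; [exact Hx | apply Rmult_le_pos; [lra | apply IZR_le; lia] |];
   unfold Rsqr; rewrite Ex, EM;
   replace (3 * m * m)%Z with (3 * (Z.abs m * Z.abs m))%Z by nia;
   rewrite !mult_IZR, <- Hs; ring).
Qed.

(** Here [x] and [y] stand for twice the side lengths, which makes their squares integers. *)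
Lemma integer_solutions (p q k : Z) (x y : R) :
  (0 < k)%Z -> (0 < p + q)%Z -> 0 <= x -> 0 <= y ->
  x * x = IZR (p * p + 3 * k * k) -> y * y = IZR (q * q + 3 * k * k) ->
  4 * (x + y) = sqrt 3 * IZR (k * (p + q)) ->
  k = 4%Z /\ exists i : nat,
    (p = - 12 * u i /\ q = 12 * u (S i) \/ q = - 12 * u i /\ p = 12 * u (S i))%Z.
Proof.
intros Hk Hpq Hx Hy Ex Ey E.
assert (Ht := Z.mul_pos_pos _ _ Hk Hpq).
destruct (three_times_square x y _ _ _ Ht Hx Ex Ey E) as (m & Hm & Xm & Em).
rewrite Rplus_comm in E.
destruct (three_times_square y x _ _ _ Ht Hy Ey Ex E) as (n & Hn & Yn & En).
assert (three : forall z c : Z, (z * z = 3 * c)%Z -> exists z', z = (3 * z')%Z).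
{ intros z c H. destruct (prime_mult 3 prime_3 z z) as [[d D]|[d D]];
    [exists c; lia| |]; exists d; lia. }
destruct (three p (m * m - k * k)%Z ltac:(lia)) as [a ->].
destruct (three q (n * n - k * k)%Z ltac:(lia)) as [b ->].
assert (Hp : 0 < sqrt 3) by (apply sqrt_lt_R0; lra).
assert (E' : (4 * (m + n) = 3 * k * (a + b))%Z).
{ replace (3 * k * (a + b))%Z with (k * (3 * a + 3 * b))%Z by ring.
  apply eq_IZR. rewrite mult_IZR, plus_IZR.
  apply (Rmult_eq_reg_l (sqrt 3)); [|lra].
  rewrite <- E, Xm, Yn. ring. }
assert (Hk2 := Z.mul_pos_pos _ _ Hk Hk).
(* 3m^2 = p^2 + 3k^2 > 0, and likewise for [n]. *)
assert (m <> 0)%Z by (intros ->; clear - Em Hk2; nia).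
assert (n <> 0)%Z by (intros ->; clear - En Hk2; nia).
destruct (diophantine a b k m n) as [K [i Hi]]; try lia.
split; [exact K|]. exists i. lia.
Qed.

(** * Lattice coordinates and reduction to normal position *)

Lemma eisenstein_diff (z w : C) : eisenstein z -> eisenstein w ->
  exists p k : Z, Re z = Re w + IZR p / 2 /\ Im z = Im w + IZR k * sqrt 3 / 2.
Proof.
intros [a [b ->]] [a' [b' ->]]. exists (2 * (a - a') - (b - b'))%Z, (b - b')%Z.
unfold omega, RtoC, Cplus, Cmult, Re, Im; cbn [fst snd].
rewrite !minus_IZR, mult_IZR, !minus_IZR. split; field.
Qed.

Lemma Zsign (z : Z) : z <> 0%Z -> exists e : Z, (e = 1 \/ e = -1)%Z /\ (0 < e * z)%Z.
Proof.
intros Hz. destruct (Z.lt_total z 0) as [H|[H|H]]; [exists (-1)%Z| |exists 1%Z]; lia.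
Qed.

Lemma Cmod_coord_ge0_sqr (x y : R) (r : R) :
  x * x + y * y = r -> 0 <= Cmod (x, y) /\ Cmod (x, y) * Cmod (x, y) = r.
Proof.
intros <-. split; [apply Cmod_ge_0|]. unfold Cmod; cbn [fst snd].
rewrite sqrt_sqrt; [ring|nra].
Qed.

Lemma isometry_axes (e1 e2 : R) (a : C) : e1 * e1 = 1 -> e2 * e2 = 1 ->
  isometry (fun z => (e1 * (Re z - Re a), e2 * (Im z - Im a))).
Proof.
intros H1 H2 [z1 z2] [w1 w2]. destruct a as [a1 a2].
unfold Cmod, Cminus, Cplus, Copp, Re, Im; cbn [fst snd]. f_equal.
transitivity ((e1 * e1) * (z1 - w1) ^ 2 + (e2 * e2) * (z2 - w2) ^ 2); [ring|].
rewrite H1, H2. ring.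
Qed.

Lemma parallelogram_perimeter (a b c d : C) : (b - a = c - d)%C ->
  perimeter [a; b; c; d] = 2 * Cmod (b - a)%C + 2 * Cmod (d - a)%C.
Proof.
intros H. assert (Hc : c = (b + d - a)%C).
{ replace c with (c - d + d)%C by ring. rewrite <- H. ring. }
unfold perimeter, sides, sum_list. cbn [combine tl app firstn map fold_right fst snd].
replace (c - b)%C with (d - a)%C by (rewrite Hc; ring).
replace (d - c)%C with (- (b - a))%C by (rewrite Hc; ring).
replace (a - d)%C with (- (d - a))%C by ring.
rewrite !Cmod_opp. ring.
Qed.

Lemma parallelogram_area (a b c d : C) : (b - a = c - d)%C ->
  area [a; b; c; d] = Rabs (cross (b - a) (d - a)).
Proof.
intros H. assert (Hc : c = (b + d - a)%C).
{ replace c with (c - d + d)%C by ring. rewrite <- H. ring. }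
unfold area, sides, sum_list. cbn [combine tl app firstn map fold_right fst snd].
subst c. destruct a as [a1 a2], b as [b1 b2], d as [d1 d2].
unfold cross, Cminus, Cplus, Copp, Re, Im; cbn [fst snd].
match goal with |- Rabs ?t / 2 = Rabs ?t' => replace t with (2 * t') by ring end.
rewrite Rabs_mult, (Rabs_right 2) by lra. field.
Qed.

(** The isometry sends [a] to the origin; the two alternatives are the two directions of travel
    around [P n]. *)
Lemma horizontal_diagonal_ac (a b c d : C) :
  ELEP [a; b; c; d] -> Im a = Im c ->
  exists (n : nat) (f : C -> C), isometry f /\
    (map f [a; b; c; d] = [RtoC 0; ptA n; ptB n; ptC n] \/
     map f [a; b; c; d] = [RtoC 0; ptC n; ptB n; ptA n]).
Proof.
intros [[Hpar Hcr] [Heq HE]] Him.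
assert (Ha := Forall_inv HE). assert (Hb := Forall_inv (Forall_inv_tail HE)).
assert (Hd := Forall_inv (Forall_inv_tail (Forall_inv_tail (Forall_inv_tail HE)))).
unfold equable in Heq.
rewrite (parallelogram_perimeter _ _ _ _ Hpar), (parallelogram_area _ _ _ _ Hpar) in Heq.
destruct (eisenstein_diff b a Hb Ha) as (p & l & Bx & By).
destruct (eisenstein_diff d a Hd Ha) as (q & k & Dx & Dy).
clear HE Ha Hb Hd.
assert (Hs : sqrt 3 * sqrt 3 = 3) by (apply sqrt_sqrt; lra).
assert (Hp : 0 < sqrt 3) by (apply sqrt_lt_R0; lra).
destruct a as [a1 a2], b as [b1 b2], c as [c1 c2], d as [d1 d2].
unfold Re, Im in Him, Bx, By, Dx, Dy; cbn [fst snd] in Him, Bx, By, Dx, Dy.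
unfold Cminus, Cplus, Copp in Hpar; cbn [fst snd] in Hpar.
injection Hpar as Hx Hy.
(* Along a horizontal diagonal the vertical components of the two sides cancel. *)
assert (Hl : IZR l = - IZR k).
{ apply (Rmult_eq_reg_r (sqrt 3)); [|lra]. lra. }
rewrite Hl in By. clear l Hl.
assert (Cx : c1 = a1 + (IZR p + IZR q) / 2) by lra.
clear Hx Hy. subst b1 b2 d1 d2 c1 c2.
unfold cross, Cminus, Cplus, Copp, Re, Im in Hcr, Heq; cbn [fst snd] in Hcr, Heq.
assert (Hk : k <> 0%Z) by (intros ->; apply Hcr; field).
assert (Hpq : (p + q <> 0)%Z).
{ intros Z. apply (f_equal IZR) in Z. rewrite plus_IZR in Z.
  apply Hcr. replace (IZR q) with (- IZR p) by lra. field. }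
clear Hcr.
(* The signs give the axis reflections that make the diagonal point right and put [d] above it. *)
destruct (Zsign _ Hpq) as (e1 & F1 & P1), (Zsign _ Hk) as (e2 & F2 & P2).
assert (E1 : (e1 * e1 = 1)%Z) by (destruct F1 as [-> | ->]; reflexivity).
assert (E2 : (e2 * e2 = 1)%Z) by (destruct F2 as [-> | ->]; reflexivity).
set (x := Cmod (IZR p / 2, - IZR k * sqrt 3 / 2)).
set (y := Cmod (IZR q / 2, IZR k * sqrt 3 / 2)).
assert (E : 4 * (2 * x + 2 * y) = sqrt 3 * IZR ((e2 * k) * (e1 * p + e1 * q))).
{ unfold x, y.
  match type of Heq with 2 * Cmod ?v + 2 * Cmod ?w = _ =>
    replace v with ((IZR p / 2, - IZR k * sqrt 3 / 2) : C) in Heq by (f_equal; field);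
    replace w with ((IZR q / 2, IZR k * sqrt 3 / 2) : C) in Heq by (f_equal; field)
  end.
  rewrite Heq.
  match goal with |- context [Rabs ?t] =>
    replace t with (sqrt 3 * IZR (k * (p + q)) / 4)
      by (rewrite mult_IZR, plus_IZR; field) end.
  assert (Ee : ((e2 * k) * (e1 * p + e1 * q) = Z.abs (k * (p + q)))%Z)
    by (assert (P := Z.mul_pos_pos _ _ P2 P1);
        destruct F1 as [-> | ->], F2 as [-> | ->]; lia).
  rewrite Ee, abs_IZR. unfold Rdiv.
  rewrite !Rabs_mult, (Rabs_right (sqrt 3)), (Rabs_right (/ 4)) by lra. field. }
clear Heq.
destruct (Cmod_coord_ge0_sqr (IZR p / 2) (- IZR k * sqrt 3 / 2)
  ((IZR p * IZR p + 3 * IZR k * IZR k) / 4)) as [X0 X2].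
{ clear - Hs. set (s := sqrt 3) in *. clearbody s. rewrite <- Hs. field. }
destruct (Cmod_coord_ge0_sqr (IZR q / 2) (IZR k * sqrt 3 / 2)
  ((IZR q * IZR q + 3 * IZR k * IZR k) / 4)) as [Y0 Y2].
{ clear - Hs. set (s := sqrt 3) in *. clearbody s. rewrite <- Hs. field. }
fold x in X0, X2. fold y in Y0, Y2. clearbody x y.
destruct (integer_solutions (e1 * p) (e1 * q) (e2 * k) (2 * x) (2 * y))
  as (K & n & Sol); [lia|lia|lra|lra| | |exact E|].
{ replace (e1 * p * (e1 * p) + 3 * (e2 * k) * (e2 * k))%Z
    with ((e1 * e1) * (p * p) + 3 * (e2 * e2) * (k * k))%Z by ring.
  rewrite E1, E2, plus_IZR, !mult_IZR. lra. }
{ replace (e1 * q * (e1 * q) + 3 * (e2 * k) * (e2 * k))%Z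
    with ((e1 * e1) * (q * q) + 3 * (e2 * e2) * (k * k))%Z by ring.
  rewrite E1, E2, plus_IZR, !mult_IZR. lra. }
apply (f_equal IZR) in E1, E2, K. rewrite mult_IZR in E1, E2, K.
assert (Ks : IZR e2 * IZR k * sqrt 3 = 4 * sqrt 3) by now rewrite K.
exists n.
(* In the first case [b] goes to [ptA n]. In the second [d] does, so the vertical reflection is
   reversed to bring [d] below the diagonal. *)
destruct Sol as [[S1 S2]|[S1 S2]];
  apply (f_equal IZR) in S1, S2; rewrite !mult_IZR in S1, S2.
- exists (fun z => (IZR e1 * (Re z - Re (a1, a2)), IZR e2 * (Im z - Im (a1, a2)))).
  split; [exact (isometry_axes _ _ (a1, a2) E1 E2)|left].
  cbn [map]. unfold ptA, ptB, ptC, RtoC, Re, Im; cbn [fst snd].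
  repeat (apply (f_equal2 (@cons C)); [apply injective_projections; cbn [fst snd]; lra|]).
  reflexivity.
- exists (fun z => (IZR e1 * (Re z - Re (a1, a2)), - IZR e2 * (Im z - Im (a1, a2)))).
  split; [refine (isometry_axes _ (- IZR e2) (a1, a2) E1 _); lra|right].
  cbn [map]. unfold ptA, ptB, ptC, RtoC, Re, Im; cbn [fst snd].
  repeat (apply (f_equal2 (@cons C)); [apply injective_projections; cbn [fst snd]; lra|]).
  reflexivity.
Qed.

(** Lets the diagonal from [b] to [d] be treated as the one through the first vertex. *)
Lemma ELEP_rotate (a b c d : C) : ELEP [a; b; c; d] -> ELEP [b; c; d; a].
Proof.
intros [[Hpar Hcr] [Heq HE]].
assert (Hc : c = (b + d - a)%C).
{ replace c with (c - d + d)%C by ring. rewrite <- Hpar. ring. }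
split; [split|split].
- rewrite Hc. ring.
- intros H. apply Hcr. rewrite <- H, Hc.
  destruct a, b, d. unfold cross, Cminus, Cplus, Copp, Re, Im; cbn [fst snd]. ring.
- unfold equable, perimeter, area, sides, sum_list in *.
  cbn [combine tl app firstn map fold_right fst snd] in *.
  match type of Heq with ?l = Rabs ?t / 2 =>
    match goal with |- ?l' = Rabs ?t' / 2 =>
      replace l' with l by ring; replace t' with t by ring end end.
  exact Heq.
- inversion_clear HE. now apply (Forall_app eisenstein [b; c; d] [a]); auto.
Qed.

Theorem theorem5 (p : list C) (Hp : ELEP p) (Hd : has_horizontal_diagonal p) :
  exists n : nat, congruent p (P n).
Proof.
destruct p as [|a [|b [|c [|d [|? ?]]]]]; try contradiction.
destruct Hd as [Hd|Hd].
- destruct (horizontal_diagonal_ac _ _ _ _ Hp Hd) as (n & f & Hf & [E|E]).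
  + exists n, f, 0%nat. split; [exact Hf|left; exact E].
  + exists n, f, 1%nat. split; [exact Hf|right; exact E].
- destruct (horizontal_diagonal_ac _ _ _ _ (ELEP_rotate _ _ _ _ Hp) Hd)
    as (n & f & Hf & [E|E]); injection E as Eb Ec Ed Ea.
  + exists n, f, 3%nat. split; [exact Hf|left].
    cbn [map]. rewrite Ea, Eb, Ec, Ed. reflexivity.
  + exists n, f, 2%nat. split; [exact Hf|right].
    cbn [map]. rewrite Ea, Eb, Ec, Ed. reflexivity.
Qed.
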